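(* Let $n\ge d\ge 1$ be integers. If $p(x)$ is a monic polynomial of degree $d$ with (all roots) nonnegative real roots, then the roots of $p(x,t)=\big(p\boxplus_d^n G_{n,d}^{[t]}\big)(x)$ are positive and distinct for all $t>0$.
   Context: Rectangular convolution: for monic degree-$d$ polynomials $p(x)=x^d+\sum_{i=1}^d a_{2i}x^{d-i}$ and $q(x)=x^d+\sum_{i=1}^d b_{2i}x^{d-i}$, with $a_0=b_0=1$, the $(n,d)$-rectangular finite free convolution is $$(p\boxplus_d^n q)(x)=x^d+\sum_{k=1}^d x^{d-k}\sum_{\substack{i,j\ge 0\\ i+j=k}}\frac{(d-i)!(d-j)!}{d!(d-k)!}\,\frac{(n+d-i)!(n+d-j)!}{(n+d)!(n+d-k)!}\,a_{2i}b_{2j}.$$ Laguerre heat polynomials: with $m^{\downarrow k}=m(m-1)\cdots(m-k+1)$ for $k\ge 1$ and $m^{\downarrow 0}=1$, let $L_d^{(\alpha)}(x)=\sum_{k=0}^d\frac{(d+\alpha)^{\downarrow k}}{(d-k)!\,k!}(-x)^{d-k}$. For $t>0$ set $G_{n,d}^{[t]}(x)=(-2t)^d\, d!\, L_d^{(n)}\!\left(\frac{x}{2t}\right)$. *)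

(* Defs.v *)
From HB Require Import structures.
From mathcomp Require Import all_boot all_order all_algebra.
From mathcomp Require Import reals.

Set Implicit Arguments.
Unset Strict Implicit.
Unset Printing Implicit Defensive.

Import Order.TTheory GRing.Theory Num.Theory.
Local Open Scope ring_scope.

Section RectangularConvolution.
Variable R : realType.

(* The subscripts a_(2i), b_(2j) are the coefficients of x^(d-i), x^(d-j):
   a_(2i) = p`_(d - i) and b_(2j) = q`_(d - j), with j = k - i. *)
Definition rect_conv (n d : nat) (p q : {poly R}) : {poly R} :=
  'X^d + \sum_(1 <= k < d.+1)
    (\sum_(i < k.+1)
       ((d - i)`! * (d - (k - i))`!)%:R / (d`! * (d - k)`!)%:R
       * (((n + d - i)`! * (n + d - (k - i))`!)%:R
          / ((n + d)`! * (n + d - k)`!)%:R)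
       * p`_(d - i) * q`_(d - (k - i))) *: 'X^(d - k).

Definition falling (m : R) (k : nat) : R := \prod_(i < k) (m - i%:R).

Definition laguerre (d : nat) (alpha : R) : {poly R} :=
  \sum_(k < d.+1)
    (falling (d%:R + alpha) k / ((d - k)`! * k`!)%:R) *: (- 'X) ^+ (d - k).

Definition laguerre_heat (n d : nat) (t : R) : {poly R} :=
  ((- (2 * t)) ^+ d * d`!%:R) *: (laguerre d n%:R \Po ((2 * t)^-1 *: 'X)).

(* A monic polynomial all of whose (complex) roots are real is the product
   below; rs then lists the roots, each repeated according to multiplicity. *)
Definition root_list (p : {poly R}) (rs : seq R) : Prop :=
  p = \prod_(r <- rs) ('X - r%:P).

End RectangularConvolution.

(* Main.v *)
Require Import Defs.
From HB Require Import structures.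
From mathcomp Require Import all_boot all_order all_algebra.
From mathcomp Require Import zify ring lra.
From mathcomp Require Import boolp reals.

Import Order.TTheory GRing.Theory Num.Theory.
Local Open Scope ring_scope.

(** The convolution with the Laguerre heat polynomial is a heat flow in
    disguise. With D = x d^2/dx^2 + (n+1) d/dx, which sends x^m to
    m (m + n) x^(m-1), the coefficients of the rectangular convolution are
    exactly those of exp(-2t D) p (rect_conv_laguerre_heat). It then remains to
    see that exp(-s D), for s > 0, sends every product of factors x - r with
    r >= 0 to a polynomial with positive and distinct roots; this is proved one
    root at a time (bessel_heat_roots).

    The commutator of D with multiplication by x is the first-order operator
    H = 2 x d/dx + (n+1), and the commutator of D with H is 2 D. Hence
    exp(-s D) conjugates multiplication by x into x - s H + s^2 D, which
    factors: with Q = exp(-s D) q and F = Q - s Q',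

      exp(-s D) (x q) = x (F - s F') - s (n+1) F     (bessel_heat_mulX).

    Suppose Q has roots y_0 > ... > y_(m-1) > 0. At a root of Q the polynomial F
    equals - s Q', whose signs alternate, so that F has one root u_k just to
    the right of each y_k and before y_(k-1). At a root of F the polynomial
    P = exp(-s D) ((x - r) q) = x (F - s F') - s (n+1) F - r Q reduces to
    - s x F' - r Q, and both terms have the same sign there because the u_k
    and the y_k interlace; at 0 it equals - s (n+1) F - r Q, again a sum of two
    terms of the same sign. So P alternates in sign along u_0 > ... > u_(m-1) > 0,
    which yields m + 1 distinct positive roots, as many as its degree
    (multiplication_step_roots). Positivity of s makes the inequalities strict,
    and this separates the roots of P even when those of p are repeated. *)

(** * Sign patterns and interlacing *)

(** Roots are listed from the largest to the smallest, so that a monic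
    polynomial has the sign (-1)^k just after its first k roots from the right. *)
Definition decreasing_below {R : numDomainType} (m : nat) (y : nat -> R) :=
  forall i j, (i < j < m)%N -> y j < y i.

Lemma decreasing_below_uniq (R : numDomainType) (m : nat) (y : nat -> R) :
  decreasing_below m y -> uniq (mkseq y m).
Proof.
move=> ydec; apply/(uniqP 0) => i j; rewrite !inE size_mkseq => im jm.
rewrite !nth_mkseq // => eqy; case: (ltngtP i j) => // lt.
  by have := ydec i j; rewrite lt jm eqy ltxx => /(_ isT).
by have := ydec j i; rewrite lt im eqy ltxx => /(_ isT).
Qed.

Lemma prod_sign (R : realDomainType) (m k : nat) (f : nat -> R) :
  (k <= m)%N -> (forall i, (i < k)%N -> f i < 0) ->
  (forall i, (k <= i < m)%N -> 0 < f i) ->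
  0 < (-1) ^+ k * \prod_(i < m) f i.
Proof.
elim: m k f => [|m IH] [|k] f // lekm fneg fpos.
- by rewrite big_ord0 mulr1.
- by rewrite expr0 mul1r prodr_gt0 // => i _; apply: fpos => /=.
have h : 0 < (-1) ^+ k * \prod_(i < m) f i.+1.
  by apply: (IH k (fun i => f i.+1)) => // i hi; [apply: fneg | apply: fpos].
rewrite big_ord_recl /= exprS.
have -> : -1 * (-1) ^+ k * (f 0%N * \prod_(i < m) f (bump 0 i)) =
  - f 0%N * ((-1) ^+ k * \prod_(i < m) f i.+1) by ring.
by rewrite mulr_gt0 // oppr_gt0 fneg.
Qed.

Lemma prod_XsubC_root (R : comNzRingType) (m k : nat) (y : nat -> R) :
  (k < m)%N -> (\prod_(i < m) ('X - (y i)%:P)).[y k] = 0.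
Proof.
move=> ltkm; rewrite horner_prod (bigD1 (Ordinal ltkm)) //=.
by rewrite hornerXsubC subrr mul0r.
Qed.

Lemma prod_XsubC_sign (R : realDomainType) (m k : nat) (y : nat -> R) (v : R) :
  (k <= m)%N -> (forall i, (i < k)%N -> v < y i) ->
  (forall i, (k <= i < m)%N -> y i < v) ->
  0 < (-1) ^+ k * (\prod_(i < m) ('X - (y i)%:P)).[v].
Proof.
move=> lekm vlt ltv; rewrite horner_prod.
under eq_bigr do rewrite hornerXsubC.
by apply: (@prod_sign _ m k (fun i => v - y i)) => // i hi;
  rewrite ?subr_lt0 ?subr_gt0; auto.
Qed.

(** The derivative at the k-th root is the product of the differences with the
    other roots, of which exactly the first k are negative. *)
Lemma deriv_prod_XsubC_sign (R : realDomainType) (m k : nat) (y : nat -> R) :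
  decreasing_below m y -> (k < m)%N ->
  0 < (-1) ^+ k * (\prod_(i < m) ('X - (y i)%:P))^`().[y k].
Proof.
move=> ydec ltkm.
(* At the root y k only the term differentiating the factor X - y k survives. *)
rewrite (bigD1 (Ordinal ltkm)) //= derivM derivXsubC mul1r !hornerE subrr mul0r.
rewrite addr0 horner_prod big_mkcond /=.
rewrite (eq_bigr (fun i : 'I_m => if i == k :> nat then 1 else y k - y i)).
  apply: (@prod_sign _ m k (fun i => if i == k then 1 else y k - y i)).
  - exact: ltnW.
  - by move=> i ltik; rewrite ltn_eqF // subr_lt0 ydec // ltik.
  move=> i /andP[leki ltim]; case: eqP => // /eqP neik.
  by rewrite subr_gt0 ydec // ltim andbT ltn_neqAle eq_sym neik.
by move=> i _; rewrite -val_eqE /=; case: eqP => //= _; rewrite hornerXsubC.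
Qed.

Lemma interlacing_decreasing (R : numDomainType) (m : nat) (y z : nat -> R) :
  (forall k, (k < m)%N -> z k < y k) ->
  (forall i j, (i < j < m)%N -> y j < z i) -> decreasing_below m y.
Proof.
move=> zlt ylt i j /andP[ij jm]; apply: (@lt_trans _ _ (z i)).
  by rewrite ylt // ij.
by apply: zlt; apply: ltn_trans jm.
Qed.

(** Alternating signs at m points, with the sign at the largest one opposite to
    the sign at +oo, force a root in each of the m intervals that lie to the
    right of these points; a polynomial of degree m has no other roots. *)
Lemma interlacing_roots (R : rcfType) (m : nat) (P : {poly R}) (z : nat -> R) :
  P \is monic -> size P = m.+1 -> decreasing_below m z ->
  (forall k, (k < m)%N -> 0 < (-1) ^+ k.+1 * P.[z k]) ->
  exists y : nat -> R,
    [/\ P = \prod_(i < m) ('X - (y i)%:P),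
        forall k, (k < m)%N -> z k < y k
      & forall i j, (i < j < m)%N -> y j < z i].
Proof.
move=> Pmon szP zdec Psign.
have [y yP] : exists y : nat -> R, forall k, (k < m)%N ->
    [/\ root P (y k), z k < y k & (0 < k)%N -> y k < z k.-1].
  suff /choice[y yP] : forall k, exists x, (k < m)%N ->
      [/\ root P x, z k < x & (0 < k)%N -> x < z k.-1] by exists y.
  move=> k; case: (ltnP k m) => [ltkm|_]; last by exists 0.
  have [b [zb bz Pb]] : exists b, [/\ z k < b, (0 < k)%N -> b <= z k.-1
      & 0 < (-1) ^+ k * P.[b]].
    case: k ltkm => [|k] ltkm.
      (* The rightmost interval is unbounded: a Cauchy bound closes it. *)
      have [B PB] := monic_Cauchy_bound Pmon.
      exists (Num.max B (z 0%N + 1)); split => //.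
        by rewrite lt_max ltrDl ltr01 orbT.
      by rewrite expr0 mul1r PB // le_max lexx.
    exists (z k); split=> //; first by rewrite zdec // ltnSn.
    by apply: Psign; apply: ltnW.
  have Pz := Psign k ltkm.
  have [x /itvP xI] :
      exists2 x, x \in `[z k, b] & root ((-1) ^+ k *: P) x.
    apply: poly_ivt; first exact: ltW.
    rewrite !hornerZ; move: Pz; rewrite exprS; nra.
  rewrite rootZ ?signr_eq0 // => Px; exists x => _.
  have xz : x != z k.
    by apply: contraTneq Pz => <-; rewrite (eqP Px) mulr0 ltxx.
  have xb : x != b.
    by apply: contraTneq Pb => <-; rewrite (eqP Px) mulr0 ltxx.
  split=> //; first by rewrite lt_neqAle eq_sym xz xI.
  by move=> k0; apply: (lt_le_trans _ (bz k0)); rewrite lt_neqAle xb xI.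
have ylt i j : (i < j < m)%N -> y j < z i.
  move=> /andP[ltij ltjm]; have [_ _ yz] := yP j ltjm.
  have j0 : (0 < j)%N by apply: leq_ltn_trans ltij.
  apply: (lt_le_trans (yz j0)).
  have := ltij; rewrite -{1}(prednK j0) ltnS leq_eqVlt => /orP[/eqP-> //|lti].
  by apply/ltW/zdec; rewrite lti /=; apply: leq_ltn_trans (leq_pred j) ltjm.
have zlt k : (k < m)%N -> z k < y k by case/yP.
exists y; split=> //.
have Pe : P = lead_coef P *: \prod_(r <- mkseq y m) ('X - r%:P).
  apply: all_roots_prod_XsubC; first by rewrite size_mkseq.
    by apply/allP => _ /mapP[i + ->]; rewrite mem_iota => /andP[_ /yP[]].
  rewrite uniq_rootsE; apply: decreasing_below_uniq.
  exact: interlacing_decreasing ylt.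
by rewrite {1}Pe (monicP Pmon) scale1r big_map
  -(big_mkord xpredT (fun i => 'X - (y i)%:P)) /index_iota subn0.
Qed.

Lemma monic_sub_lower (R : nzRingType) (P A : {poly R}) :
  P \is monic -> (size A < size P)%N ->
  (P - A \is monic) /\ size (P - A) = size P.
Proof.
move=> Pmon ltA; have ltNA : (size (- A) < size P)%N by rewrite size_polyN.
rewrite size_polyDl //; split=> //.
by rewrite monicE lead_coefDl //; apply/eqP/monicP.
Qed.

(** The induction step on the number of roots. The polynomial displayed is the
    image under exp(-s D) of (x - r) q when Q is the image of q and a = n + 1;
    two interlacings, of F with Q and then of this polynomial with F and 0, give
    its roots. *)
Lemma multiplication_step_roots (R : rcfType) (m : nat) (y : nat -> R)
    (Q : {poly R}) (s a r : R) (F := Q - s *: Q^`()) :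
  0 < s -> 0 < a -> 0 <= r ->
  Q = \prod_(i < m) ('X - (y i)%:P) -> decreasing_below m y ->
  (forall i, (i < m)%N -> 0 < y i) ->
  exists w : nat -> R,
    [/\ 'X * (F - s *: F^`()) - (s * a) *: F - r *: Q =
          \prod_(i < m.+1) ('X - (w i)%:P),
        decreasing_below m.+1 w
      & forall i, (i < m.+1)%N -> 0 < w i].
Proof.
move=> s0 a0 r0 QE ydec ypos.
have Qmon : Q \is monic by rewrite QE monic_prod_XsubC.
have szQ : size Q = m.+1.
  by rewrite QE size_prod_XsubC /index_enum -enumT size_enum_ord.
have Q0 : Q != 0 by rewrite monic_neq0.
have [Fmon szF] : (F \is monic) /\ size F = m.+1.
  rewrite -szQ; apply: monic_sub_lower => //.
  by rewrite (leq_ltn_trans (size_scale_leq _ _)) // lt_size_deriv.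
have F0 : F != 0 by rewrite monic_neq0.
have [u [FE yu uy]] : exists u : nat -> R,
    [/\ F = \prod_(i < m) ('X - (u i)%:P),
        forall k, (k < m)%N -> y k < u k
      & forall i j, (i < j < m)%N -> u j < y i].
  apply: interlacing_roots => // k ltkm.
  have Qy : Q.[y k] = 0 by rewrite QE prod_XsubC_root.
  have := @deriv_prod_XsubC_sign _ m k y ydec ltkm; rewrite -QE /F !hornerE Qy.
  by rewrite exprS => h; have := mulr_gt0 s0 h; lra.
clearbody F.
have upos k : (k < m)%N -> 0 < u k.
  by move=> ltkm; apply: (lt_trans (ypos k ltkm)); apply: yu.
have udec : decreasing_below m u := interlacing_decreasing _ _ _ _ yu uy.
set P := _ - _ - _.
have PE : P = 'X * F - (s *: ('X * F^`()) + (s * a) *: F + r *: Q).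
  by rewrite /P mulrBr -scalerAr; ring.
have XFmon : 'X * F \is monic by rewrite monicMl ?monicX.
have szXF : size ('X * F) = m.+2 by rewrite mulrC size_mulX // szF.
have [Pmon szP] : (P \is monic) /\ size P = m.+2.
  rewrite PE -szXF; apply: monic_sub_lower => //; rewrite szXF ltnS.
  rewrite (leq_trans (size_polyD _ _)) // geq_max; apply/andP; split; last first.
    by rewrite -szQ size_scale_leq.
  rewrite (leq_trans (size_polyD _ _)) // geq_max; apply/andP; split; last first.
    by rewrite -szF size_scale_leq.
  rewrite (leq_trans (size_scale_leq _ _)) //.
  rewrite (leq_trans (size_polyMleq _ _)) // size_polyX /= -szF.
  exact: lt_size_deriv.
(* The test points are the roots of F followed by 0. *)
pose z k := if (k < m)%N then u k else 0.
have [w [PwE zw wz]] : exists w : nat -> R,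
    [/\ P = \prod_(i < m.+1) ('X - (w i)%:P),
        forall k, (k < m.+1)%N -> z k < w k
      & forall i j, (i < j < m.+1)%N -> w j < z i].
  apply: interlacing_roots => //.
    move=> i j /andP[ij]; rewrite ltnS /z => jm.
    rewrite (leq_trans ij jm); case: ifP => jm'; first by rewrite udec // ij.
    by apply: upos; apply: leq_trans jm.
  move=> k; rewrite ltnS /z => lekm; case: ifP => ltkm.
    have Fu : F.[u k] = 0 by rewrite FE prod_XsubC_root.
    have hF := @deriv_prod_XsubC_sign _ m k u udec ltkm.
    (* u k lies between y k and y k.-1, hence has exactly k roots of Q above it. *)
    have hQ : 0 < (-1) ^+ k * Q.[u k].
      rewrite QE; apply: prod_XsubC_sign => // i.
        by move=> ik; rewrite uy // ik.
      move=> /andP[ki im]; apply: (le_lt_trans _ (yu k ltkm)).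
      move: ki; rewrite leq_eqVlt => /orP[/eqP-> //|ki].
      by apply/ltW/ydec; rewrite ki.
    rewrite -FE in hF.
    have h1 := mulr_gt0 (mulr_gt0 s0 (upos k ltkm)) hF.
    have h2 := mulr_ge0 r0 (ltW hQ).
    by rewrite PE !(hornerE, hornerMX) Fu exprS /=; lra.
  have -> : k = m by apply/eqP; rewrite eqn_leq lekm leqNgt ltkm.
  have hF : 0 < (-1) ^+ m * F.[0].
    rewrite FE; apply: prod_XsubC_sign => // i /andP[/leq_ltn_trans h/h].
    by rewrite ltnn.
  have hQ : 0 < (-1) ^+ m * Q.[0].
    rewrite QE; apply: prod_XsubC_sign => // i /andP[/leq_ltn_trans h/h].
    by rewrite ltnn.
  have h1 := mulr_gt0 (mulr_gt0 s0 a0) hF.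
  have h2 := mulr_ge0 r0 (ltW hQ).
  by rewrite PE !hornerE exprS /=; lra.
exists w; split=> //; first exact: interlacing_decreasing wz.
move=> k km; apply: (le_lt_trans _ (zw k km)); rewrite /z.
by case: ifP => // /upos/ltW.
Qed.

(** * The heat flow of the Bessel operator *)

Lemma natr_fact_neq0 (R : numDomainType) (m : nat) : m`!%:R != 0 :> R.
Proof. by rewrite pnatr_eq0 -lt0n fact_gt0. Qed.

Section BesselHeat.
Variables (R : realFieldType) (n : nat).
Implicit Types (p q : {poly R}) (s : R).

(** Up to a factor 4, the radial part of the Laplacian of a space of dimension
    2n + 2, written in the squared radius. *)
Definition bessel p := 'X * p^`()^`() + n.+1%:R *: p^`().

(** The exponential exp(-s D), truncated at order N; D lowers degrees, so nothing
    is lost on polynomials of size at most N. *)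
Definition bessel_heat N s p :=
  \sum_(j < N) ((- s) ^+ j / j`!%:R) *: iter j bessel p.

Fact bessel_is_linear : linear bessel.
Proof. by move=> c p q; rewrite /bessel !derivD !derivZ -!mul_polyC; ring. Qed.
HB.instance Definition _ :=
  GRing.isLinear.Build R {poly R} {poly R} _ bessel bessel_is_linear.

Lemma besselD p q : bessel (p + q) = bessel p + bessel q.
Proof. exact: linearD. Qed.

Lemma besselZ c p : bessel (c *: p) = c *: bessel p.
Proof. exact: linearZ. Qed.

Lemma iter_bessel_linear j c p q :
  iter j bessel (c *: p + q) = c *: iter j bessel p + iter j bessel q.
Proof. by elim: j => //= j ->; rewrite linearP. Qed.

Lemma coef_bessel p l : (bessel p)`_l = (l.+1 * (l.+1 + n))%:R * p`_l.+1.
Proof.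
rewrite /bessel coefD coefXM coefZ !coef_deriv.
case: l => [|l] /=; first by rewrite mul1n add1n mulr1n add0r.
rewrite !mulr_natl -!mulrnA -mulrnDr; congr (_ *+ _).
by rewrite -mulnDr addnS.
Qed.

(** Stated without division: each application of D divides out one step of the
    product of factorials l! (l + n)!. *)
Lemma coef_iter_bessel j p l :
  (l`! * (l + n)`!)%:R * (iter j bessel p)`_l =
  ((l + j)`! * (l + j + n)`!)%:R * p`_(l + j).
Proof.
elim: j l => [|j IH] l /=; first by rewrite addn0.
rewrite coef_bessel addnS -addSn -IH mulrA -natrM; congr (_%:R * _).
by rewrite addSn !factS; ring.
Qed.

Lemma coef_iter_bessel_eq0 j p l :
  (size p <= l + j)%N -> (iter j bessel p)`_l = 0.
Proof.
move=> szp; apply/eqP; have := coef_iter_bessel j p l.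
rewrite [p`_ _]nth_default // mulr0 => /eqP.
by rewrite natrM !mulf_eq0 !(negPf (natr_fact_neq0 _ _)).
Qed.

Lemma iter_bessel_eq0 j p : (size p <= j)%N -> iter j bessel p = 0.
Proof.
move=> szp; apply/polyP => l.
by rewrite coef0 coef_iter_bessel_eq0 // (leq_trans szp) ?leq_addl.
Qed.

Lemma bessel_heat_linear N s c p q :
  bessel_heat N s (c *: p + q) = c *: bessel_heat N s p + bessel_heat N s q.
Proof.
rewrite scaler_sumr -big_split; apply: eq_bigr => j _ /=.
by rewrite iter_bessel_linear scalerDr !scalerA [c * _]mulrC.
Qed.

Lemma bessel_heat_widen N s p :
  (size p <= N)%N -> bessel_heat N.+1 s p = bessel_heat N s p.
Proof.
move=> szp; rewrite /bessel_heat big_ord_recr /= iter_bessel_eq0 //.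
by rewrite scaler0 addr0.
Qed.

(** The commutator of D with multiplication by x. With these two operators it
    spans a copy of sl_2, which is what makes the exponential computable. *)
Definition weight p := 2%:R *: ('X * p^`()) + n.+1%:R *: p.

Fact weight_is_linear : linear weight.
Proof. by move=> c p q; rewrite /weight derivD derivZ -!mul_polyC; ring. Qed.
HB.instance Definition _ :=
  GRing.isLinear.Build R {poly R} {poly R} _ weight weight_is_linear.

Lemma bessel_mulX p : bessel ('X * p) = 'X * bessel p + weight p.
Proof.
rewrite /bessel /weight !(derivM, derivX, derivD, mul1r) -!mul_polyC; ring.
Qed.

Lemma bessel_weight p : bessel (weight p) = weight (bessel p) + 2%:R *: bessel p.
Proof.
rewrite /bessel /weight !(derivM, derivX, derivD, derivZ, mul1r) -!mul_polyC; ring.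
Qed.

(** Moving x to the left through j + 1 copies of D produces the commutator once
    per copy, and moving it in turn to the left produces 2 D once per pair. *)
Lemma iter_bessel_mulX j p :
  iter j.+1 bessel ('X * p) =
  'X * iter j.+1 bessel p + j.+1%:R *: weight (iter j bessel p) +
  (j.+1 * j)%:R *: iter j bessel p.
Proof.
elim: j => [|j IH]; first by rewrite /= bessel_mulX scale1r muln0 scale0r addr0.
rewrite iterS IH 2!besselD 2!besselZ bessel_mulX bessel_weight.
set A := weight _; set B := bessel (bessel _); set C := bessel _.
rewrite -!mul_polyC !natrM -!natr1 !rmorphM !rmorphD /=; ring.
Qed.

(** Multiplication by x, conjugated by exp(-s D), becomes x - s H + s^2 D with
    H the operator [weight]; in terms of d/dx this is
    (x (1 - s d/dx) - s (n+1)) (1 - s d/dx), and F is the image of Q under the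
    rightmost factor. *)
Lemma bessel_heat_mulX N s q (Q := bessel_heat N s q)
    (F := Q - s *: Q^`()) : (size q <= N)%N ->
  bessel_heat N.+1 s ('X * q) =
  'X * (F - s *: F^`()) - (s * n.+1%:R) *: F.
Proof.
move=> szq; pose c j : R := (- s) ^+ j / j`!%:R.
have cS j : c j.+1 * j.+1%:R = - s * c j.
  rewrite /c exprS factS natrM; field.
  by rewrite natr_fact_neq0 nat1r pnatr_eq0.
have -> : bessel_heat N.+1 s ('X * q) =
    'X * bessel_heat N.+1 s q +
    (\sum_(j < N) (c j.+1 * j.+1%:R) *: weight (iter j bessel q) +
     \sum_(j < N) (c j.+1 * j.+1%:R * j%:R) *: iter j bessel q).
  rewrite /bessel_heat !big_ord_recl mulrDr -addrA; congr (_ + _).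
    by rewrite scalerAr.
  rewrite mulr_sumr -!big_split; apply: eq_bigr => j _ /=.
  rewrite add0n -!iterS iter_bessel_mulX.
  move: (iter j bessel q) (weight (iter j bessel q)) (iter j.+1 bessel q).
  move=> B W A.
  rewrite !scalerDr !scalerA -/(c j.+1) natrM mulrA.
  by rewrite scalerAr addrA.
rewrite bessel_heat_widen // -/Q.
have -> : \sum_(j < N) (c j.+1 * j.+1%:R) *: weight (iter j bessel q) =
    - s *: weight Q.
  rewrite /Q linear_sum scaler_sumr; apply: eq_bigr => j _.
  by rewrite linearZ scalerA cS.
have -> : \sum_(j < N) (c j.+1 * j.+1%:R * j%:R) *: iter j bessel q =
    s ^+ 2 *: bessel Q.
  under eq_bigr do rewrite cS.
  rewrite /Q /bessel_heat {F Q}; case: N szq => [|N] szq.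
    by rewrite !big_ord0 linear0 scaler0.
  rewrite big_ord_recl /= mulr0 scale0r add0r linear_sum big_ord_recr /=.
  rewrite besselZ -iterS iter_bessel_eq0 // scaler0 addr0 scaler_sumr.
  apply: eq_bigr => j _; rewrite linearZ scalerA -mulrA cS /c /bump /=.
  by congr (_ *: _); ring.
rewrite /F /weight /bessel !(derivM, derivX, derivB, derivZ, mul1r).
rewrite -!mul_polyC !rmorphM ?rmorphN /=; ring.
Qed.

End BesselHeat.

Arguments bessel {R} n p.
Arguments bessel_heat {R} n N s p.

(** Induction on the number of roots: writing the new factor as x - r, the image
    of x q is given by bessel_heat_mulX and that of r q by linearity. *)
Lemma bessel_heat_roots (R : rcfType) (n : nat) (s : R) (rs : seq R) :
  0 < s -> (forall r, r \in rs -> 0 <= r) ->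
  exists y : nat -> R,
    [/\ bessel_heat n (size rs).+1 s (\prod_(r <- rs) ('X - r%:P)) =
          \prod_(i < size rs) ('X - (y i)%:P),
        decreasing_below (size rs) y
      & forall i, (i < size rs)%N -> 0 < y i].
Proof.
move=> s0; elim: rs => [|r rs IH] rs_ge0 /=.
  exists (fun=> 0); split=> [|i j /andP[]|] //.
  by rewrite /bessel_heat big_ord1 big_nil big_ord0 /= expr0 divr1 scale1r.
have [|y [QE ydec ypos]] := IH.
  by move=> x xrs; apply: rs_ge0; rewrite inE xrs orbT.
have r0 : 0 <= r by apply: rs_ge0; rewrite mem_head.
have [w [PE wdec wpos]] :=
  multiplication_step_roots _ _ _ _ _ _ _ s0 (ltr0Sn R n) r0 (erefl _) ydec ypos.
exists w; split=> //; rewrite big_cons -PE.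
set q := \prod_(x <- rs) _.
have szq : (size q <= (size rs).+1)%N by rewrite size_prod_XsubC.
have -> : ('X - r%:P) * q = (- r) *: q + 'X * q.
  by rewrite -mul_polyC rmorphN; ring.
by rewrite bessel_heat_linear bessel_heat_widen // bessel_heat_mulX // QE
  scaleNr addrC.
Qed.

(** * The convolution as a heat flow *)

Lemma falling_fact (R : realType) (m k : nat) :
  (k <= m)%N -> falling (m%:R : R) k * (m - k)`!%:R = m`!%:R.
Proof.
elim: k => [|k IH] km; first by rewrite /falling big_ord0 mul1r subn0.
rewrite -IH; last exact: ltnW.
rewrite /falling big_ord_recr /= -natrB; last exact: ltnW.
rewrite -mulrA -natrM subnS; move: km; rewrite -subn_gt0.
by case: (m - k)%N => // a _; rewrite factS.
Qed.

Lemma coef_rev_sum (R : nzRingType) (d : nat) (c : nat -> R) (l : nat) :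
  (\sum_(k < d.+1) c k *: 'X^(d - k))`_l = if (l <= d)%N then c (d - l)%N else 0.
Proof.
rewrite (reindex_inj rev_ord_inj) /=.
rewrite (eq_bigr (fun k : 'I_d.+1 => c (d - k)%N *: 'X^k)); last first.
  by move=> k _; rewrite !subSS subKn // -ltnS.
by rewrite -(poly_def d.+1 (fun k => c (d - k)%N)) coef_poly ltnS.
Qed.

(** Up to the factor (-2t)^j / j!, which is the weight of D^j in exp(-2t D), these
    coefficients are the inverse of (d - j)! (n + d - j)! / (d! (n + d)!), the
    only part of the factorial ratio of the convolution that depends on j. *)
Lemma coef_laguerre_heat (R : realType) (n d j : nat) (t : R) :
  t != 0 -> (j <= d)%N ->
  (laguerre_heat n d t)`_(d - j) =
  (- (2 * t)) ^+ j / j`!%:R *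
  ((d`! * (n + d)`!)%:R / ((d - j)`! * (n + d - j)`!)%:R).
Proof.
move=> t0 lejd; rewrite /laguerre_heat /laguerre linear_sum scaler_sumr.
pose u := 2 * t; rewrite -/u.
have u0 : u != 0 by rewrite mulf_neq0 ?pnatr_eq0.
rewrite (eq_bigr (fun k : 'I_d.+1 =>
  ((- u) ^+ k / k`!%:R *
   ((d`! * (n + d)`!)%:R / ((d - k)`! * (n + d - k)`!)%:R)) *: 'X^(d - k))).
  by rewrite (@coef_rev_sum _ d (fun k => (- u) ^+ k / k`!%:R *
    ((d`! * (n + d)`!)%:R / ((d - k)`! * (n + d - k)`!)%:R)))
    leq_subr subKn.
move=> k _; have lekd : (k <= d)%N by rewrite -ltnS.
have compXn m : (- 'X) ^+ m \Po (u^-1 *: 'X) = (- u^-1) ^+ m *: 'X^m.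
  by rewrite rmorphXn /= linearN /= comp_polyX -scaleNr exprZn.
rewrite /= comp_polyZ compXn !scalerA; congr (_ *: _).
rewrite -natrD (addnC n d) !natrM.
rewrite -(falling_fact R _ _ (leq_trans lekd (leq_addr n d))).
rewrite -invrN exprVn -[X in (- u) ^+ X * _](subnKC lekd) exprD.
have := natr_fact_neq0 R (d + n - k); have := natr_fact_neq0 R (d - k).
have := natr_fact_neq0 R k.
have : (- u) ^+ (d - k) != 0 by rewrite expf_neq0 // oppr_eq0.
move: (_ ^+ (d - k)) (_ ^+ k) (k`!%:R) ((d - k)`!%:R) ((d + n - k)`!%:R).
by move=> a b c e f a0 c0 e0 f0; field; rewrite a0 c0 e0 f0.
Qed.

(** The factorial ratios of the convolution cancel those in the coefficients of
    the Laguerre heat polynomial, leaving in each term (-2t)^j / j! times the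
    ratio by which D^j acts on coefficients. *)
Lemma rect_conv_laguerre_heat (R : realType) (n d : nat) (t : R) (p : {poly R}) :
  t != 0 -> p \is monic -> size p = d.+1 ->
  rect_conv n d p (laguerre_heat n d t) = bessel_heat n d.+1 (2 * t) p.
Proof.
move=> t0 pmon szp; apply/polyP => l.
pose c k := \sum_(i < k.+1)
       ((d - i)`! * (d - (k - i))`!)%:R / (d`! * (d - k)`!)%:R
       * (((n + d - i)`! * (n + d - (k - i))`!)%:R
          / ((n + d)`! * (n + d - k)`!)%:R)
       * p`_(d - i) * (laguerre_heat n d t)`_(d - (k - i)).
have fn0 := @natr_fact_neq0 R.
have c0 : c 0%N = 1.
  rewrite /c big_ord1 coef_laguerre_heat // !subn0 expr0.
  have -> : p`_d = 1 by rewrite -(monicP pmon) lead_coefE szp.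
  by rewrite fact0 !natrM; field; rewrite !fn0.
(* The leading term 'X^d of the convolution is the missing term k = 0. *)
have -> : rect_conv n d p (laguerre_heat n d t) =
    \sum_(k < d.+1) c k *: 'X^(d - k).
  rewrite /rect_conv -(big_mkord xpredT (fun k => c k *: 'X^(d - k))).
  by rewrite big_ltn // c0 scale1r subn0.
rewrite coef_rev_sum /bessel_heat coef_sum.
case: leqP => [leld|ltdl]; last first.
  rewrite big1 // => j _.
  by rewrite coefZ coef_iter_bessel_eq0 ?mulr0 // szp ltn_addr.
(* The terms with j > d - l vanish because p has degree d. *)
rewrite -(big_mkord xpredT (fun j =>
  ((- (2 * t)) ^+ j / j`!%:R *: iter j (bessel n) p)`_l)).
rewrite (big_cat_nat _ (n := (d - l).+1)) //= ?ltnS ?leq_subr //.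
rewrite [X in _ + X]big1_seq ?addr0; last first.
  move=> j /andP[_]; rewrite mem_index_iota => /andP[ltj _]; rewrite coefZ.
  by rewrite coef_iter_bessel_eq0 ?mulr0 // szp -ltn_subLR.
rewrite big_mkord /c (reindex_inj rev_ord_inj) /=; apply: eq_bigr => j _.
have lej : (j <= d - l)%N by rewrite -ltnS.
rewrite subSS subKn // coef_laguerre_heat ?(leq_trans lej) ?leq_subr //.
have -> : (d - (d - l - j) = l + j)%N by lia.
have -> : (n + d - (d - l - j) = l + j + n)%N by lia.
have -> : (n + d - (d - l) = l + n)%N by lia.
rewrite subKn // coefZ.
have -> : (iter j (bessel n) p)`_l =
    ((l + j)`! * (l + j + n)`!)%:R / (l`! * (l + n)`!)%:R * p`_(l + j).
  have h := coef_iter_bessel _ n j p l.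
  rewrite mulrAC -h natrM; field; by rewrite !fn0.
by rewrite !natrM; field; rewrite !fn0.
Qed.

Theorem theorem3p4 (R : realType) (n d : nat) (p : {poly R})
    (hd : (1 <= d)%N) (hnd : (d <= n)%N)
    (p_monic : p \is monic) (p_deg : size p = d.+1)
    (p_roots : exists2 rs : seq R,
        root_list p rs & forall r, r \in rs -> 0 <= r) :
  forall t : R, 0 < t ->
    exists rs : seq R,
      [/\ root_list (rect_conv n d p (laguerre_heat n d t)) rs,
          forall r, r \in rs -> 0 < r
        & uniq rs].
Proof.
move=> t t0; have [rs pE rs_ge0] := p_roots.
have szrs : size rs = d by apply: succn_inj; rewrite -p_deg pE size_prod_XsubC.
have s0 : 0 < 2 * t by rewrite mulr_gt0.
have [y [hE ydec ypos]] := bessel_heat_roots _ n _ _ s0 rs_ge0.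
rewrite szrs -pE in hE; rewrite szrs in ydec ypos.
exists (mkseq y d); split.
- rewrite /root_list rect_conv_laguerre_heat ?gt_eqF // hE /mkseq big_map.
  by rewrite -(big_mkord xpredT (fun i => 'X - (y i)%:P)) /index_iota subn0.
- by move=> _ /mapP[i + ->]; rewrite mem_iota => /andP[_ /ypos].
exact: decreasing_below_uniq.
Qed.
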